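(* Let $G_m$ be a parametric regulatory network and $R$ a well-formed set of influence constraints. For every set of transitions $T\subseteq\Delta(G_m)$, the abstract parametrisation set $p^\#_R(T)$ is the smallest convex sublattice of $\mathbb P(G_m)$ containing $p_R(T)$; i.e. $p^\#_R(T)=[p_R(T)]$, where for $X\subseteq\mathbb P(G_m)$, $[X]$ is the empty lattice if $X=\emptyset$ and otherwise the set $\{P\mid L\le P\le U\}$ with $L,U$ the componentwise minimum and maximum of the elements of $X$.
   Context: An influence graph is $G=(V,I)$ with $V=\{1,\dots,n\}$ and $I\subseteq V\times V$; for $v\in V$ its regulators are $n^-(v)=\{u\mid (u,v)\in I\}$. A vector $m\in\mathbb N^n$ gives maximal values; write $D_v=\{0,\dots,m_v\}$. The pair $G_m=(G,m)$ is a parametric regulatory network (PRN). The regulator states of $v$ are $\Omega_v=\prod_{u\in n^-(v)}D_u$ (vectors indexed by the regulators of $v$); for $\omega\in\Omega_v$, $u\in n^-(v)$ and $k\in D_u$, $\omega[u\leftarrow k]$ is $\omega$ with component $u$ replaced by $k$. The parameters are $\Omega=\bigcup_{v\in V}\{v\}\times\Omega_v$, and a parametrisation is a vector $P\in\mathbb P(G_m)=\prod_{\langle v,\omega\rangle\in\Omega}D_v$ with coordinates $P_{v,\omega}\in D_v$. Parametrisations are ordered componentwise ($P\le P'$ iff $P_{v,\omega}\le P'_{v,\omega}$ for all coordinates); the least element $\bot$ is the zero vector and the greatest $\top$ has $\top_{v,\omega}=m_v$. A pair $(L,U)$ denotes the convex sublattice $\{P\mid L\le P\le U\}$, which is the empty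 lattice $\varnothing$ when $L\not\le U$. States are $S(G_m)=\prod_{v}D_v$; for a state $x$, $\omega_v(x)\in\Omega_v$ is the projection of $x$ onto the regulators of $v$. The transitions $\Delta(G_m)$ are pairs $x\to y$ of states such that for some $v$, $y$ equals $x$ except $y_v=x_v+1\le m_v$ (written $x\xrightarrow{v,+}y$) or $y_v=x_v-1\ge 0$ (written $x\xrightarrow{v,-}y$). For a transition $t$, $\mathcal P_{x\xrightarrow{v,+}y}=\{P\mid P_{v,\omega_v(x)}\ge x_v+1\}$ and $\mathcal P_{x\xrightarrow{v,-}y}=\{P\mid P_{v,\omega_v(x)}\le x_v-1\}$; $p(\emptyset)=\mathbb P(G_m)$ and $p(T)=\bigcap_{t\in T}\mathcal P_t$ for $T\ne\emptyset$. Influence constraints: a set $R\subseteq V\times V\times\{+1,-1,\mathrm o\}$ is well-formed if for all $(u,v,c)\in R$, $u\in n^-(v)$, and no pair $(u,v)$ has both $(u,v,+1)$ and $(u,v,-1)$ in $R$. Define $\mathcal P_{(u,v,+1)}=\{P\mid\forall\omega\in\Omega_v\,\forall x_u\in\{1,\dots,m_u\}: P_{v,\omega[u\leftarrow x_u]}\ge P_{v,\omega[u\leftarrow x_u-1]}\}$, $\mathcal P_{(u,v,-1)}$ likewise with $\le$, and $\mathcal P_{(u,v,\mathrm o)}=\{P\mid\exists\omega\in\Omega_v\,\exists x_u\in\{1,\dots,m_u\}: P_{v,\omega[u\leftarrow x_u]}\ne P_{v,\omega[u\leftarrow x_u-1]}\}$. Let $p_R(T)=p(T)\cap\bigcap_{r\in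 R}\mathcal P_r$. The monotonicity order $\preceq_v$ on $\Omega_v$: $\omega\preceq_v\omega'$ iff for all $u\in n^-(v)$: $\omega_u\le\omega'_u$ if $(u,v,+1)\in R$, $\omega_u\ge\omega'_u$ if $(u,v,-1)\in R$, and $\omega_u=\omega'_u$ otherwise; $\omega\parallel_v\omega'$ means incomparable, and $\prec_v$ is the strict version. Narrowing operators (all map $\varnothing$ to $\varnothing$). For a transition: $\nabla_{x\xrightarrow{v,+}y}(L,U)=(\max(L,\bot[(v,\omega_v(x))\leftarrow x_v+1]),U)$ and $\nabla_{x\xrightarrow{v,-}y}(L,U)=(L,\min(U,\top[(v,\omega_v(x))\leftarrow x_v-1]))$, where $\max,\min$ are componentwise and $Q[(v,\omega)\leftarrow k]$ replaces coordinate $(v,\omega)$ by $k$. For $s\in\{+1,-1\}$, $\nabla_{(u,v,s)}(L,U)$ is the fixpoint of iterating from $(L,U)$ the map $f(L,U)=(L',U')$ with, for all $\omega\in\Omega_v$, $L'_{v,\omega}=\max(\{L_{v,\omega}\}\cup\{L_{v,\omega[u\leftarrow\omega_u-s]}\mid\omega_u-s\in D_u\})$, $U'_{v,\omega}=\min(\{U_{v,\omega}\}\cup\{U_{v,\omega[u\leftarrow\omega_u+s]}\mid\omega_u+s\in D_u\})$, all other coordinates unchanged. For observability, let $A_{u,v}(L,U)=\{\omega\in\Omega_v\mid\exists x_u\in\{1,\dots,m_u\}: L_{v,\omega[u\leftarrow x_u]}<U_{v,\omega[u\leftarrow x_u-1]}\ \text{or}\ U_{v,\omega[u\leftarrow x_u]}>L_{v,\omega[u\leftarrow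 x_u-1]}\}$. Then $\nabla_{(u,v,\mathrm o)}(L,U)=\varnothing$ if $A_{u,v}(L,U)=\emptyset$, and otherwise $(L',U')$ where, writing $A=A_{u,v}(L,U)$, $\overline B=\{\omega\in A\mid L_{v,\omega}<U_{v,\omega}\wedge\forall\omega'\in A: L_{v,\omega}=L_{v,\omega'}\wedge(\omega'\preceq_v\omega\vee\omega\parallel_v\omega')\}$ and $\underline B=\{\omega\in A\mid L_{v,\omega}<U_{v,\omega}\wedge\forall\omega'\in A: U_{v,\omega}=U_{v,\omega'}\wedge(\omega\preceq_v\omega'\vee\omega\parallel_v\omega')\}$; $L'$ is $L$ with coordinate $(v,\omega)$ increased by 1 if $\overline B=\{\omega\}$ and $L'=L$ otherwise; $U'$ is $U$ with coordinate $(v,\omega)$ decreased by 1 if $\underline B=\{\omega\}$ and $U'=U$ otherwise. For a subset $R'\subseteq R$, $\nabla_{R'}(L,U)$ is the fixpoint of iterating from $(L,U)$ the composition of the $\nabla_r$, $r\in R'$. Finally $p^\#_R(\emptyset)=\nabla_R(\bot,\top)$ and $p^\#_R(T\cup\{t\})=\nabla_{\{(u,v',c)\in R\mid v'=v\}}(\nabla_t(p^\#_R(T)))$ where $v$ is the node changed by $t$. *)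

(* Defs.v *)
From HB Require Import structures.
From mathcomp Require Import all_boot.

(* A PRN G_m = (G, m): nodes V = 'I_nn (i.e. {0..nn-1}, standing for {1..n}),
   influence relation I (infl u v <-> (u,v) \in I), and maximal values mx. *)
Record PRN := { nn : nat; infl : rel 'I_nn; mx : 'I_nn -> nat }.

Set Implicit Arguments.
Unset Strict Implicit.
Unset Printing Implicit Defensive.


Section PRNdefs.
Variable G : PRN.

Definition Node := 'I_(nn G).
Definition Val (v : Node) := 'I_(mx G v).+1.
Definition Reg (v : Node) := {u : Node | infl G u v}.
Definition Omega (v : Node) := {dffun forall u : Reg v, Val (val u)}.
Definition PIdx := {v : Node & Omega v}.
Definition Par := {dffun forall c : PIdx, Val (tag c)}.
Definition State := {dffun forall v : Node, Val v}.

(* build a parametrisation from nat-valued coordinates (values are always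
   within range where used; inord clamps otherwise) *)
Definition mkPar (f : PIdx -> nat) : Par :=
  @finfun PIdx (fun c => Val (tag c)) (fun c => inord (f c)).

Definition leP (P Q : Par) : bool := [forall c, (P c : nat) <= Q c].

Definition bot : Par := mkPar (fun _ => 0).
Definition top : Par := mkPar (fun c => mx G (tag c)).
Definition pmax (P Q : Par) : Par := mkPar (fun c => maxn (P c) (Q c)).
Definition pmin (P Q : Par) : Par := mkPar (fun c => minn (P c) (Q c)).
Definition upd (Q : Par) (c0 : PIdx) (k : nat) : Par :=
  mkPar (fun c => if c == c0 then k else Q c).

Definition cget (c : PIdx) (u : Node) : nat :=
  let: existT w om := c in
  match (insub u : option (Reg w)) with
  | Some u' => nat_of_ord (om u')
  | None => 0
  end.

Definition updOm (w : Node) (om : Omega w) (u : Node) (k : nat) : Omega w :=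
  @finfun (Reg w) (fun u' => Val (val u'))
    (fun u' => if val u' == u then inord k else om u').

Definition cset (c : PIdx) (u : Node) (k : nat) : PIdx :=
  let: existT w om := c in existT Omega w (updOm om u k).

Definition proj (x : State) (v : Node) : Omega v :=
  @finfun (Reg v) (fun u => Val (val u)) (fun u => x (val u)).

(* a transition x --v,+--> y is encoded by (x, v, true), x --v,--> y by
   (x, v, false); the target y is determined by (x, v, sign). *)
Definition Trans := (State * Node * bool)%type.
Definition valid_trans (t : Trans) : bool :=
  let: (x, v, b) := t in if b then (x v : nat) < mx G v else 0 < (x v : nat).
Definition tnode (t : Trans) : Node := t.1.2.

Definition Ptrans (t : Trans) : {set Par} :=
  let: (x, v, b) := t in
  let c := existT Omega v (proj x v) in
  if b then [set P : Par | (x v : nat) + 1 <= P c]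
  else [set P : Par | (P c : nat) <= (x v : nat) - 1].

Definition ptr (s : seq Trans) : {set Par} := \bigcap_(t <- s) Ptrans t.

Inductive csign := CPos | CNeg | CObs.
Definition csign_eqb (a b : csign) : bool :=
  match a, b with
  | CPos, CPos | CNeg, CNeg | CObs, CObs => true
  | _, _ => false end.
Lemma csign_eqP : Equality.axiom csign_eqb.
Proof. by case; case; constructor. Qed.
HB.instance Definition _ := hasDecEq.Build csign csign_eqP.

Definition Constraint := (Node * Node * csign)%type.

Definition well_formed (R : seq Constraint) : Prop :=
  (forall r, r \in R -> infl G r.1.1 r.1.2) /\
  (forall u v : Node, ~~ (((u, v, CPos) \in R) && ((u, v, CNeg) \in R))).

Definition Pcons (r : Constraint) : {set Par} :=
  let: (u, v, s) := r in
  match s with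
  | CPos => [set P : Par | [forall c : PIdx, (tag c == v) ==>
      [forall k : 'I_(mx G u).+1, (0 < (k : nat)) ==>
        ((P (cset c u k.-1) : nat) <= P (cset c u k))]]]
  | CNeg => [set P : Par | [forall c : PIdx, (tag c == v) ==>
      [forall k : 'I_(mx G u).+1, (0 < (k : nat)) ==>
        ((P (cset c u k.-1) : nat) >= P (cset c u k))]]]
  | CObs => [set P : Par | [exists c : PIdx, (tag c == v) &&
      [exists k : 'I_(mx G u).+1, (0 < (k : nat)) &&
        ((P (cset c u k) : nat) != P (cset c u k.-1))]]]
  end.

Definition pR (R : seq Constraint) (s : seq Trans) : {set Par} :=
  ptr s :&: \bigcap_(r <- R) Pcons r.

(* None = the empty lattice; Some (L, U) = {P | L <= P <= U}
   (which is also the empty lattice when ~~ leP L U) *)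
Definition AbsD := option (Par * Par).

Definition gamma (a : AbsD) : {set Par} :=
  match a with
  | None => set0
  | Some (L, U) => [set P | leP L P && leP P U]
  end.

Definition hull (X : {set Par}) : AbsD :=
  if X == set0 then None
  else Some (mkPar (fun c => \big[minn/mx G (tag c)]_(P in X) (P c : nat)),
             mkPar (fun c => \max_(P in X) (P c : nat))).

Definition norm (a : AbsD) : AbsD :=
  match a with
  | Some (L, U) => if leP L U then Some (L, U) else None
  | None => None
  end.

Definition ntrans (t : Trans) (a : AbsD) : AbsD :=
  match norm a with
  | None => None
  | Some (L, U) =>
    let: (x, v, b) := t in
    let c := existT Omega v (proj x v) in
    if b then Some (pmax L (upd bot c ((x v : nat) + 1)), U)
    else Some (L, pmin U (upd top c ((x v : nat) - 1)))
  end.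

(* "the fixpoint of iterating f from a": the iteration is decreasing on the
   finite type AbsD, hence stationary after #|AbsD| steps *)
Definition fixA (f : AbsD -> AbsD) (a : AbsD) : AbsD := iter #|{: AbsD}| f a.

Definition stepS (u v : Node) (pos : bool) (L U : Par) : Par * Par :=
  (mkPar (fun c => if tag c == v then
      let x := cget c u in
      if pos then (if 0 < x then maxn (L c) (L (cset c u x.-1)) else L c)
      else (if x < mx G u then maxn (L c) (L (cset c u x.+1)) else L c)
    else L c),
   mkPar (fun c => if tag c == v then
      let x := cget c u in
      if pos then (if x < mx G u then minn (U c) (U (cset c u x.+1)) else U c)
      else (if 0 < x then minn (U c) (U (cset c u x.-1)) else U c)
    else U c)).

Definition nmono (u v : Node) (pos : bool) (a : AbsD) : AbsD :=
  fixA (fun b => match norm b with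
                 | None => None
                 | Some (L, U) => Some (stepS u v pos L U) end) a.

(* monotonicity order preceq_v (w.r.t. the constraint set R) on the
   regulator states of v, represented as parameters c with tag c = v *)
Definition prec (R : seq Constraint) (v : Node) (c c' : PIdx) : bool :=
  [forall u : Node, infl G u v ==>
     (if (u, v, CPos) \in R then cget c u <= cget c' u
      else if (u, v, CNeg) \in R then cget c u >= cget c' u
      else cget c u == cget c' u)].

Definition incomp (R : seq Constraint) (v : Node) (c c' : PIdx) : bool :=
  ~~ prec R v c c' && ~~ prec R v c' c.

Definition nobs (R : seq Constraint) (u v : Node) (a : AbsD) : AbsD :=
  match norm a with
  | None => None
  | Some (L, U) =>
    let A := [set c : PIdx | (tag c == v) &&
        [exists k : 'I_(mx G u).+1, (0 < (k : nat)) &&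
          (((L (cset c u k) : nat) < U (cset c u k.-1)) ||
           ((U (cset c u k) : nat) > L (cset c u k.-1)))]] in
    if A == set0 then None else
    let Bup := [set c in A | ((L c : nat) < U c) &&
        [forall c' in A, ((L c : nat) == L c') &&
                         (prec R v c' c || incomp R v c c')]] in
    let Bdn := [set c in A | ((L c : nat) < U c) &&
        [forall c' in A, ((U c : nat) == U c') &&
                         (prec R v c c' || incomp R v c c')]] in
    let L' := match [pick c in Bup] with
              | Some c0 => if Bup == [set c0] then upd L c0 ((L c0 : nat) + 1) else L
              | None => L end in
    let U' := match [pick c in Bdn] with
              | Some c0 => if Bdn == [set c0] then upd U c0 ((U c0 : nat) - 1) else U
              | None => U end in
    Some (L', U')
  end.

Definition ncons (R : seq Constraint) (r : Constraint) : AbsD -> AbsD :=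
  let: (u, v, s) := r in
  match s with
  | CPos => nmono u v true
  | CNeg => nmono u v false
  | CObs => nobs R u v
  end.

(* nabla_{R'}: fixpoint of the composition of the nabla_r, r in R'
   (R' given as a list; R is the global constraint set used for preceq) *)
Definition nset (R R' : seq Constraint) (a : AbsD) : AbsD :=
  fixA (foldr (fun r f => ncons R r \o f) id R') a.

(* p#_R(T) for T given as a list of transitions; the head of the list is the
   transition added last:  p#(t :: s) = nabla_{R_v}(nabla_t(p#(s))) *)
Fixpoint psharp (R : seq Constraint) (s : seq Trans) : AbsD :=
  match s with
  | [::] => nset R R (Some (bot, top))
  | t :: s' => nset R [seq r <- R | r.1.2 == tnode t] (ntrans t (psharp R s'))
  end.

End PRNdefs.

(* Main.v *)
(** Every narrowing operator only discards parametrisations violating a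
    constraint, so [psharp] contains [pR].  For the converse, stop at a fixpoint
    [(L, U)]: at each node [v] both [L] and [U] are monotone for the order on
    regulator states.  If [L] violates the observability of some [u], it is
    constant along [u], and then changing it at a single cell makes it depend on
    every regulator (look at a 2x2 square through that cell).  Raising [L] by one
    keeps monotonicity at any cell that is free ([L < U]) and maximal in its level
    set, and such a cell different from a given [w] exists, for otherwise [w]
    would be the only raisable cell and the observability operator would act.
    Hence [L] is attained at every coordinate by an element of [pR], and dually
    [U]; parametrisations chosen separately at the nodes are glued together. *)

Require Import Defs.
From HB Require Import structures.
From mathcomp Require Import all_boot.
From mathcomp Require Import order zify.

Set Implicit Arguments.
Unset Strict Implicit.
Unset Printing Implicit Defensive.

(** * Decreasing iterations on a finite type *)

Lemma iter_card_fixed (T : finType) (le : rel T) (f : T -> T) (a : T) :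
  reflexive le -> transitive le -> antisymmetric le ->
  (forall x, le (f x) x) -> f (iter #|T| f a) = iter #|T| f a.
Proof.
move=> le_refl le_trans le_anti f_dec.
have iter_dec m x : le (iter m f x) x.
  elim: m => [|m IH]; first exact: le_refl.
  exact: le_trans (f_dec _) IH.
(* Pigeonhole: the [#|T|.+1] iterates cannot all differ, so the last equals an earlier one. The next
   iterate after that one is then squeezed between equal values. *)
have /trajectP[i lt_i eq_i] : looping f a #|T|.
  rewrite -[looping _ _ _]negbK -looping_uniq; apply/negP => /card_uniqP.
  rewrite size_traject => card_n.
  by have := max_card (mem (traject f a #|T|.+1)); rewrite card_n ltnn.
rewrite eq_i; apply: le_anti; rewrite f_dec -{1}eq_i.
by rewrite -(subnK lt_i) iterD /= iter_dec.
Qed.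

(** * Cells (a node with one of its regulator states) and coordinates of parametrisations *)

Section Cells.
Variable G : PRN.
Implicit Types (c : PIdx G) (u v : Node G).

Lemma tag_cset c u k : tag (cset c u k) = tag c.
Proof. by case: c. Qed.

Lemma cget_le c u : cget c u <= mx G u.
Proof.
case: c => v om; rewrite /cget; case: insubP => // u' _ <-.
by rewrite -ltnS ltn_ord.
Qed.

Lemma cget_cset c u k u' : k <= mx G u -> infl G u (tag c) ->
  cget (cset c u k) u' = if u' == u then k else cget c u'.
Proof.
case: c => v om /= le_k uv; case: insubP => [w _ <-|not_u'v].
  rewrite ffunE; case: eqP => // wu.
  by rewrite inordK // ltnS wu.
by case: eqP => // u'u; rewrite u'u uv in not_u'v.
Qed.

Lemma cell_ext c c' : tag c = tag c' ->
  (forall u, infl G u (tag c) -> cget c u = cget c' u) -> c = c'.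
Proof.
case: c c' => [v om] [v' om'] /= vv'; case: v' / vv' in om' * => eq_om.
congr existT; apply/ffunP => u; apply: val_inj => /=.
by have := eq_om (val u) (valP u); rewrite /= valK.
Qed.

Lemma cset_cget c u : infl G u (tag c) -> cset c u (cget c u) = c.
Proof.
move=> uv; apply: cell_ext; first exact: tag_cset.
by move=> u' _; rewrite cget_cset ?cget_le //; case: eqP => // ->.
Qed.

Lemma cset_cset c u j k : j <= mx G u -> k <= mx G u -> infl G u (tag c) ->
  cset (cset c u j) u k = cset c u k.
Proof.
move=> le_j le_k uv; apply: cell_ext; first by rewrite !tag_cset.
by move=> u' _; rewrite !cget_cset ?tag_cset //; case: eqP.
Qed.

Lemma csetC c u u' j k : u != u' -> j <= mx G u -> k <= mx G u' ->
  infl G u (tag c) -> infl G u' (tag c) ->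
  cset (cset c u j) u' k = cset (cset c u' k) u j.
Proof.
move=> neq le_j le_k uv u'v; apply: cell_ext; first by rewrite !tag_cset.
move=> w _; rewrite !cget_cset ?tag_cset //.
by case: (w =P u') => // ->; case: eqP => // eq_u; rewrite eq_u eqxx in neq.
Qed.

Lemma mkParE (f : PIdx G -> nat) c : f c <= mx G (tag c) -> mkPar f c = f c :> nat.
Proof. by move=> le_f; rewrite /mkPar ffunE inordK. Qed.

Lemma Par_le (P : Par G) c : P c <= mx G (tag c).
Proof. by rewrite -ltnS. Qed.

Lemma Par_ext (P Q : Par G) : (forall c, P c = Q c :> nat) -> P = Q.
Proof. by move=> eqPQ; apply/ffunP => c; apply: val_inj; apply: eqPQ. Qed.

Lemma par_leP (P Q : Par G) : reflect (forall c, P c <= Q c) (Defs.leP P Q).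
Proof. exact: forallP. Qed.

Lemma updE (P : Par G) c0 k c : k <= mx G (tag c0) ->
  upd P c0 k c = (if c == c0 then k else P c) :> nat.
Proof. by move=> le_k; rewrite mkParE; case: eqP => // [->|_]; rewrite ?Par_le. Qed.

End Cells.

(** * The order on regulator states and the signed constraints *)

Section Monotonicity.
Variables (G : PRN) (R : seq (Constraint G)).
Hypothesis wfR : well_formed R.
Implicit Types (c : PIdx G) (u v : Node G) (f : PIdx G -> nat).

Lemma wf_infl u v s : (u, v, s) \in R -> infl G u v.
Proof. by case: wfR => wf _ /wf. Qed.

Lemma wf_neg u v : (u, v, CNeg) \in R -> (u, v, CPos) \in R = false.
Proof. by case: wfR => _ /(_ u v); case: (_ \in R) => //= /negP. Qed.

(** The orders of all the nodes are gathered into one partial order on [PIdx G], in which cells of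
    different nodes are incomparable. *)
Definition cell_le c c' := (tag c == tag c') && prec R (tag c) c c'.

Lemma cell_leP c c' : reflect
  (tag c = tag c' /\ forall u, infl G u (tag c) ->
     if (u, tag c, CPos) \in R then cget c u <= cget c' u
     else if (u, tag c, CNeg) \in R then cget c' u <= cget c u
     else cget c u == cget c' u)
  (cell_le c c').
Proof.
apply: (iffP andP) => [[/eqP tagE /forallP le_c]|[tagE le_c]]; split=> //.
- by move=> u uv; have /implyP/(_ uv) := le_c u.
- exact/eqP.
- by apply/forallP=> u; apply/implyP=> /le_c.
Qed.

Lemma cell_le_refl : reflexive cell_le.
Proof. by move=> c; apply/cell_leP; split=> // u _; do 2?case: ifP. Qed.

Lemma cell_le_trans : transitive cell_le.
Proof.
move=> c2 c1 c3 /cell_leP[t12 le12] /cell_leP[t23 le23]; apply/cell_leP.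
split=> [|u uv]; first by rewrite t12.
have := le12 u uv; have := le23 u; rewrite -t12 => /(_ uv).
by do 2?case: ifP => _; lia.
Qed.

Lemma cell_le_anti : antisymmetric cell_le.
Proof.
move=> c c' /andP[/cell_leP[tE le1] /cell_leP[_ le2]].
apply: cell_ext => // u uv; have := le1 u uv; have := le2 u.
by rewrite -tE => /(_ uv); do 2?case: ifP => _; lia.
Qed.

Definition incr_in u v f := forall c, tag c = v -> 0 < cget c u ->
  f (cset c u (cget c u).-1) <= f c.

Definition decr_in u v f := forall c, tag c = v -> 0 < cget c u ->
  f c <= f (cset c u (cget c u).-1).

Definition mono_at v f := forall c c', tag c = v -> cell_le c c' -> f c <= f c'.

(** Induction on the L1 distance between [c] and [c']: each component on which they differ carries a
    sign, and one unit step along it brings the cells closer without breaking [cell_le]. *)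
Lemma steps_mono_at v f :
  (forall u, (u, v, CPos) \in R -> incr_in u v f) ->
  (forall u, (u, v, CNeg) \in R -> decr_in u v f) ->
  mono_at v f.
Proof.
move=> f_pos f_neg c c'.
(* With truncated subtraction, each summand is an absolute difference. *)
pose d c c' := \sum_(u : Node G) ((cget c u - cget c' u) + (cget c' u - cget c u)).
have [n] := ubnP (d c c'); elim: n c c' => // n IH c c' lt_d tc le_cc'.
have [-> // | neq_cc'] := eqVneq c c'.
have /cell_leP[tE le_u] := le_cc'; rewrite tc in tE le_u.
have [u uv neq_u] : exists2 u, infl G u v & cget c u != cget c' u.
  apply/exists_inP; apply: contraR neq_cc' => /exists_inPn eq_u.
  apply/eqP/cell_ext; rewrite tc // => u /eq_u; rewrite negbK => /eqP; exact.
have uv' : infl G u (tag c') by rewrite -tE.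
have uvc : infl G u (tag c) by rewrite tc.
have cs w x k := @cget_cset G w u x k.
have d_lt c1 c1' : (forall w, w != u -> cget c1 w = cget c w) ->
    (forall w, w != u -> cget c1' w = cget c' w) ->
    (cget c1 u - cget c1' u) + (cget c1' u - cget c1 u) <
    (cget c u - cget c' u) + (cget c' u - cget c u) -> d c1 c1' < n.
  move=> e1 e1' lt_u; apply: leq_trans _ (lt_d : d c c' <= n).
  rewrite /d (bigD1 u) //= [in X in _ < X](bigD1 u) //= -addSn leq_add //.
  by apply: leq_sum => w wu; rewrite e1 ?e1'.
(* Both signs step downwards in [u]: from the upper cell [c'] if [u] is an activator, from the lower
   cell [c] if it is an inhibitor. *)
have := le_u u uv; case: ifP => [pos|npos].
  move=> le_cu; have lt_cu : cget c u < cget c' u by rewrite ltn_neqAle neq_u.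
  have le_k : (cget c' u).-1 <= mx G u by have := cget_le c' u; lia.
  apply: leq_trans _ (f_pos u pos c' _ _) => //; last by lia.
  apply: IH => //.
    apply: d_lt => // [w wu|]; rewrite !cs // ?(negbTE wu) // eqxx; lia.
  apply/cell_leP; rewrite tag_cset tc; split=> // w wv.
  rewrite !cs //; case: eqP => [->|_]; last exact: le_u.
  by rewrite pos; lia.
case: ifP => [neg|_ eq_u]; last by rewrite eq_u in neq_u.
move=> le_cu; have lt_cu : cget c' u < cget c u by rewrite ltn_neqAle eq_sym neq_u.
have le_k : (cget c u).-1 <= mx G u by have := cget_le c u; lia.
apply: leq_trans (f_neg u neg c _ _) _ => //; first by lia.
apply: IH => //; last 2 first.
- by rewrite tag_cset.
- apply/cell_leP; rewrite tag_cset tc; split=> // w wv.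
  rewrite !cs //; case: eqP => [->|_]; last exact: le_u.
  by rewrite npos neg; lia.
by apply: d_lt => // [w wu|]; rewrite !cs // ?(negbTE wu) // eqxx; lia.
Qed.

Lemma Pcons_posP u v (P : Par G) : infl G u v -> reflect
  (incr_in u v (fun c => P c)) (P \in Pcons (u, v, CPos)).
Proof.
move=> uv; rewrite inE; apply: (iffP forallP) => [mP c tc c_gt0|incP c].
  have uvc : infl G u (tag c) by rewrite tc.
  have le_k : cget c u < (mx G u).+1 by rewrite ltnS cget_le.
  have /implyP/(_ (introT eqP tc))/forallP/(_ (Ordinal le_k))/implyP/(_ c_gt0) := mP c.
  by rewrite /= cset_cget.
apply/implyP=> /eqP tc; apply/forallP=> k; apply/implyP=> k_gt0.
have uvc : infl G u (tag c) by rewrite tc.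
have le_k : k <= mx G u by rewrite -ltnS.
have := incP (cset c u k) (etrans (tag_cset _ _ _) tc).
by rewrite cget_cset // eqxx cset_cset //; [apply | lia].
Qed.

Lemma Pcons_negP u v (P : Par G) : infl G u v -> reflect
  (decr_in u v (fun c => P c)) (P \in Pcons (u, v, CNeg)).
Proof.
move=> uv; rewrite inE; apply: (iffP forallP) => [mP c tc c_gt0|incP c].
  have uvc : infl G u (tag c) by rewrite tc.
  have le_k : cget c u < (mx G u).+1 by rewrite ltnS cget_le.
  have /implyP/(_ (introT eqP tc))/forallP/(_ (Ordinal le_k))/implyP/(_ c_gt0) := mP c.
  by rewrite /= cset_cget.
apply/implyP=> /eqP tc; apply/forallP=> k; apply/implyP=> k_gt0.
have uvc : infl G u (tag c) by rewrite tc.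
have le_k : k <= mx G u by rewrite -ltnS.
have := incP (cset c u k) (etrans (tag_cset _ _ _) tc).
by rewrite cget_cset // eqxx cset_cset //; [apply | lia].
Qed.

Lemma cell_le_pred u v c : (u, v, CPos) \in R -> tag c = v ->
  cell_le (cset c u (cget c u).-1) c.
Proof.
move=> pos tc; apply/cell_leP; rewrite tag_cset tc; split=> // w wv.
have le_k : (cget c u).-1 <= mx G u by have := cget_le c u; lia.
rewrite cget_cset ?tc ?(wf_infl pos) //; case: eqP => [->|_].
  by rewrite pos; lia.
by do 2?case: ifP.
Qed.

Lemma cell_ge_pred u v c : (u, v, CNeg) \in R -> tag c = v ->
  cell_le c (cset c u (cget c u).-1).
Proof.
move=> neg tc; apply/cell_leP; rewrite tag_cset tc; split=> // w wv.
have le_k : (cget c u).-1 <= mx G u by have := cget_le c u; lia.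
rewrite cget_cset ?tc ?(wf_infl neg) //; case: eqP => [->|_].
  by rewrite (wf_neg neg) neg; lia.
by do 2?case: ifP.
Qed.

Lemma mono_Pcons v (P : Par G) s u : mono_at v (fun c => P c) ->
  (u, v, s) \in R -> s != CObs -> P \in Pcons (u, v, s).
Proof.
move=> mP; case: s => // uv _.
  apply/(Pcons_posP _ (wf_infl uv)) => c tc _; apply: mP; rewrite ?tag_cset //.
  exact: cell_le_pred uv tc.
apply/(Pcons_negP _ (wf_infl uv)) => c tc _; apply: mP => //.
exact: cell_ge_pred uv tc.
Qed.

(** Constraints are grouped by target node, since witnesses are built one node at a time and glued
    at the end. *)
Definition satisfies v (P : Par G) := forall r, r \in R -> r.1.2 = v -> P \in Pcons r.

Lemma satisfies_mono v (P : Par G) : satisfies v P -> mono_at v (fun c => P c).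
Proof.
move=> sat; apply: steps_mono_at => u uv.
  by apply/(Pcons_posP _ (wf_infl uv)); apply: sat uv _.
by apply/(Pcons_negP _ (wf_infl uv)); apply: sat uv _.
Qed.

End Monotonicity.

(** * Maximal elements of finite orders *)

Lemma finite_maximal (T : finType) (le : rel T) (A : {set T}) x :
  reflexive le -> transitive le -> antisymmetric le -> x \in A ->
  exists y, [/\ y \in A, le x y & forall z, z \in A -> le y z -> z = y].
Proof.
move=> le_refl le_trans le_anti xA.
have x_x : (x \in A) && le x x by rewrite xA le_refl.
(* Take [y] above [x] in [A] with the fewest elements above it: anything in [A] strictly larger
   would have fewer still. *)
case: (@arg_minnP _ x (fun y => (y \in A) && le x y)
  (fun y => #|[pred z | le y z]|) x_x) => y /andP[yA xy] ymin.
exists y; split=> // z zA yz; apply/eqP; apply: contraT => neq.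
have : (z \in A) && le x z by rewrite zA (le_trans _ _ _ xy yz).
move/ymin; rewrite leqNgt => /negP[]; apply/proper_card/properP; split.
  by apply/subsetP=> w; rewrite !inE; apply: le_trans.
exists y; rewrite !inE ?le_refl //; apply: contra neq => zy.
by apply/eqP/le_anti; rewrite zy.
Qed.

(* Raising [L] by one at a free cell that is maximal in its level set keeps it
   monotone; [o] is a cell to be left untouched. *)
Lemma free_level_max (T : finType) (le : rel T) (D : pred T) (A : {set T})
    (L U : T -> nat) (o : option T) :
  reflexive le -> transitive le -> antisymmetric le ->
  (forall x y, D x -> le x y -> [/\ D y, L x <= L y & U x <= U y]) ->
  {subset A <= D} -> (forall x, D x -> L x < U x -> x \in A) ->
  (forall x, x \in A -> exists y, [/\ D y, L y < U y & L y = L x]) ->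
  A != set0 ->
  (forall x, [set c in A | (L c < U c) &&
    [forall c' in A, (L c == L c') && (le c' c || ~~ le c c')]] != [set x]) ->
  exists f, [/\ D f, L f < U f, o != Some f &
                forall g, le f g -> g != f -> L f < L g].
Proof.
move=> le_refl le_trans le_anti mono A_D freeA lineA A_n0 not1.
(* Climb from a free cell to a maximal cell of its level set. It stays free, since [L] is unchanged
   and [U] can only grow. *)
have level x : D x -> L x < U x -> exists f,
    [/\ D f, L f < U f, le x f, L f = L x & forall g, le f g -> g != f -> L f < L g].
  move=> Dx free_x; pose B := [set y | le x y & L y == L x].
  have xB : x \in B by rewrite inE le_refl eqxx.
  have [f [/setIdP[xf /eqP Lf] _ fmax]] := finite_maximal le_refl le_trans le_anti xB.
  have [Df _ Uf] := mono x f Dx xf.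
  exists f; split=> // [|g fg gf]; first by rewrite Lf; apply: leq_trans Uf.
  have [_ Lfg _] := mono f g Df fg.
  rewrite ltn_neqAle Lfg andbT; apply: contra gf => /eqP LE; apply/eqP/fmax => //.
  by rewrite inE (le_trans _ _ _ xf fg) -LE Lf eqxx.
have [x0 /lineA[y0 [Dy0 free_y0 _]]] := set0Pn _ A_n0.
have [f0 [Df0 free_f0 _ _ f0max]] := level y0 Dy0 free_y0.
case: o => [w|]; last by exists f0.
have [/existsP[f /and4P[Df free_f wf /forall_inP fmax]]|/existsPn no_f] := boolP
  [exists f, [&& D f, L f < U f, w != f & [forall g in le f, (g != f) ==> (L f < L g)]]].
  by exists f; split=> // g fg gf; have /implyP := fmax g fg; apply.
(* If only the forbidden cell [w] is suitable, the climb from any free cell ends at [w]; so [w] lies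
   above every free cell, at the same level. *)
have free_w x : D x -> L x < U x -> [/\ D w, L w < U w, le x w & L w = L x].
  move=> Dx free_x; have [f [Df free_f xf Lf fmax]] := level x Dx free_x.
  suff -> : w = f by [].
  apply/eqP; apply: contraR (no_f f) => wf; rewrite Df free_f wf.
  by apply/forall_inP=> g fg; apply/implyP; apply: fmax.
have [Dw free_ww _ _] := free_w _ Dy0 free_y0.
have wA := freeA w Dw free_ww.
have Lw c : c \in A -> L w = L c.
  by move=> /lineA[y [Dy free_y <-]]; have [] := free_w y Dy free_y.
have wmax c : c \in A -> le w c -> le c w.
  move=> cA wc; have [Dc _ Uc] := mono w c Dw wc.
  by have [] := free_w c Dc (leq_trans _ Uc) => //; rewrite -Lw.
(* Then [L] is constant on [A], and [w] is the only cell in the set excluded by [not1]. *)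
case/eqP: (not1 w); apply/setP=> c; rewrite !inE.
apply/and3P/eqP => [[cA free_c /forall_inP/(_ w wA)/andP[_]]|->]; last first.
  split=> //; apply/forall_inP=> c' c'A; rewrite (Lw c') // eqxx.
  by case wc': (le w c'); rewrite ?orbT ?wmax.
have [_ _ cw _] := free_w c (A_D c cA) free_c; rewrite cw orbF => wc.
by apply: le_anti; rewrite cw wc.
Qed.

(** * Narrowing operators as decreasing maps, and their fixpoints *)

Section Refinement.
Variables (G : PRN) (R : seq (Constraint G)).
Implicit Types (c : PIdx G) (u v : Node G) (a b : AbsD G) (D : {pred Node G}).

(** For each [D] this is a partial order on abstract values with least element [None]. The set [D]
    records the only nodes whose bounds may have moved, which later shows that narrowing at one node
    leaves the others alone. *)
Definition refines D a b : bool :=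
  match a, b with
  | None, _ => true
  | Some _, None => false
  | Some (L', U'), Some (L, U) => [forall c : PIdx G,
      [&& L c <= L' c, U' c <= U c &
        (tag c \in D) || ((L' c == L c :> nat) && (U' c == U c :> nat))]]
  end.

Lemma refinesP D (L' U' L U : Par G) : reflect
  (forall c, [/\ L c <= L' c, U' c <= U c &
     tag c \notin D -> L' c = L c :> nat /\ U' c = U c :> nat])
  (refines D (Some (L', U')) (Some (L, U))).
Proof.
apply: (iffP forallP) => ref c; have := ref c.
  case/and3P=> -> -> /orP[->|/andP[/eqP-> /eqP->]] //.
by case=> -> ->; case: (tag c \in D) => //= [[]// -> ->]; rewrite !eqxx.
Qed.

Lemma refines_refl D : reflexive (refines D).
Proof. by case=> [[L U]|] //; apply/refinesP. Qed.

Lemma refines_trans D : transitive (refines D).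
Proof.
move=> [[L2 U2]|] [[L1 U1]|] [[L3 U3]|] //.
move=> /refinesP r12 /refinesP r23; apply/refinesP => c.
have [L12 U12 e12] := r12 c; have [L23 U23 e23] := r23 c.
split; [exact: leq_trans L12|exact: leq_trans U23|move=> cD].
by have [-> ->] := e12 cD; apply: e23.
Qed.

Lemma refines_anti D : antisymmetric (refines D).
Proof.
move=> [[L1 U1]|] [[L2 U2]|] // /andP[/refinesP r12 /refinesP r21].
by congr (Some (_, _)); apply: Par_ext => c; have [] := r12 c; have [] := r21 c; lia.
Qed.

Lemma sub_refines D D' a b : {subset D <= D'} -> refines D a b -> refines D' a b.
Proof.
move=> sub; case: a b => [[L' U']|] [[L U]|] // /refinesP ref; apply/refinesP => c.
have [leL leU eqD] := ref c; split=> // cD'; apply: eqD.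
by apply: contra cD'; apply: sub.
Qed.

Lemma refines_norm D a : refines D (norm a) a.
Proof. by case: a => [[L U]|] //=; case: ifP => // _; apply: refines_refl. Qed.

Lemma refines_fixA D f a : (forall b, refines D (f b) b) -> refines D (fixA f a) a.
Proof.
move=> ref_f; rewrite /fixA; elim: #|_| => [|n IH]; first exact: refines_refl.
exact: refines_trans (ref_f _) IH.
Qed.

Lemma fixA_fixed D f a : (forall b, refines D (f b) b) -> f (fixA f a) = fixA f a.
Proof.
apply: iter_card_fixed; [exact: refines_refl|exact: refines_trans|exact: refines_anti].
Qed.

Lemma stepS_L u v (pos : bool) (L U : Par G) c : (stepS u v pos L U).1 c =
  (if tag c == v then
     if pos then
       if 0 < cget c u then maxn (L c) (L (cset c u (cget c u).-1)) else L c
     else if cget c u < mx G u then maxn (L c) (L (cset c u (cget c u).+1)) else L c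
   else L c) :> nat.
Proof.
have lt k : L (cset c u k) <= mx G (tag c) by rewrite -(tag_cset c u k) Par_le.
by rewrite mkParE //=; do ?case: ifP => _; rewrite ?geq_max ?Par_le ?lt.
Qed.

Lemma stepS_U u v (pos : bool) (L U : Par G) c : (stepS u v pos L U).2 c =
  (if tag c == v then
     if pos then
       if cget c u < mx G u then minn (U c) (U (cset c u (cget c u).+1)) else U c
     else if 0 < cget c u then minn (U c) (U (cset c u (cget c u).-1)) else U c
   else U c) :> nat.
Proof.
by rewrite mkParE //=; do ?case: ifP => _; rewrite ?geq_min ?Par_le.
Qed.

Definition nmono_step u v pos (b : AbsD G) : AbsD G :=
  match norm b with
  | None => None
  | Some (L, U) => Some (stepS u v pos L U)
  end.

Lemma refines_nmono_step u v pos b : refines (pred1 v) (nmono_step u v pos b) b.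
Proof.
rewrite /nmono_step; case: b => [[L U]|] //=; case: ifP => // _.
rewrite [stepS _ _ _ _ _]surjective_pairing; apply/refinesP => c.
rewrite stepS_L stepS_U inE; split; last by move/negbTE->.
  by do ?case: ifP => _; rewrite ?leq_maxl.
by do ?case: ifP => _; rewrite ?geq_minl.
Qed.

(** This set and the next two are $A_{u,v}$, $\overline B$ and $\underline B$; they copy the local
    definitions of [nobs], so that [nobsE] holds by computation. *)
Definition sensitive u v (L U : Par G) : {set PIdx G} :=
  [set c : PIdx G | (tag c == v) &&
     [exists k : 'I_(mx G u).+1, (0 < (k : nat)) &&
       (((L (cset c u k) : nat) < U (cset c u k.-1)) ||
        ((U (cset c u k) : nat) > L (cset c u k.-1)))]].

Definition raisable u v (L U : Par G) : {set PIdx G} :=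
  [set c in sensitive u v L U | ((L c : nat) < U c) &&
     [forall c' in sensitive u v L U, ((L c : nat) == L c') &&
        (prec R v c' c || incomp R v c c')]].

Definition lowerable u v (L U : Par G) : {set PIdx G} :=
  [set c in sensitive u v L U | ((L c : nat) < U c) &&
     [forall c' in sensitive u v L U, ((U c : nat) == U c') &&
        (prec R v c c' || incomp R v c c')]].

Definition raise u v (L U : Par G) : Par G :=
  match [pick c in raisable u v L U] with
  | Some c0 => if raisable u v L U == [set c0] then upd L c0 ((L c0 : nat) + 1) else L
  | None => L
  end.

Definition lower u v (L U : Par G) : Par G :=
  match [pick c in lowerable u v L U] with
  | Some c0 => if lowerable u v L U == [set c0] then upd U c0 ((U c0 : nat) - 1) else U
  | None => U
  end.

Lemma nobsE u v a : nobs R u v a =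
  match norm a with
  | None => None
  | Some (L, U) => if sensitive u v L U == set0 then None
                   else Some (raise u v L U, lower u v L U)
  end.
Proof. by []. Qed.

Variant raise_spec u v (L U : Par G) : Par G -> Prop :=
  | RaiseCell c0 (Q : Par G) of raisable u v L U = [set c0] & tag c0 = v & L c0 < U c0
      & (forall c, Q c = (if c == c0 then (L c0).+1 else L c) :> nat) :
      raise_spec u v L U Q
  | RaiseNone of (forall c0, raisable u v L U != [set c0]) : raise_spec u v L U L.

Lemma raiseP u v L U : raise_spec u v L U (raise u v L U).
Proof.
rewrite /raise; case: pickP => [c0 c0B|no_c]; last first.
  by constructor=> c; apply/eqP=> /setP/(_ c); rewrite no_c !inE eqxx.
have /setIdP[/setIdP[/eqP tc0 _] /andP[lt_LU _]] := c0B.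
case: eqP => [B1|Bn]; last first.
  by constructor=> c; apply/eqP=> B1; move: c0B Bn; rewrite B1 => /set1P->.
apply: (RaiseCell B1) => // c.
rewrite updE addn1 //; exact: leq_trans lt_LU (Par_le _ _).
Qed.

Variant lower_spec u v (L U : Par G) : Par G -> Prop :=
  | LowerCell c0 (Q : Par G) of lowerable u v L U = [set c0] & tag c0 = v & L c0 < U c0
      & (forall c, Q c = (if c == c0 then (U c0).-1 else U c) :> nat) :
      lower_spec u v L U Q
  | LowerNone of (forall c0, lowerable u v L U != [set c0]) : lower_spec u v L U U.

Lemma lowerP u v L U : lower_spec u v L U (lower u v L U).
Proof.
rewrite /lower; case: pickP => [c0 c0B|no_c]; last first.
  by constructor=> c; apply/eqP=> /setP/(_ c); rewrite no_c !inE eqxx.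
have /setIdP[/setIdP[/eqP tc0 _] /andP[lt_LU _]] := c0B.
case: eqP => [B1|Bn]; last first.
  by constructor=> c; apply/eqP=> B1; move: c0B Bn; rewrite B1 => /set1P->.
apply: (LowerCell B1) => // c.
rewrite updE subn1 //; exact: leq_trans (leq_pred _) (Par_le _ _).
Qed.

Lemma refines_nobs u v a : refines (pred1 v) (nobs R u v a) a.
Proof.
rewrite nobsE; case: a => [[L U]|] //=; case: ifP => // _; case: ifP => // _.
have raiseL c : L c <= raise u v L U c /\ (tag c != v -> raise u v L U c = L c :> nat).
  case: raiseP => [c0 Q _ <- _ ->|_]; last by split.
  by case: eqP => [->|_]; rewrite ?eqxx ?leqnSn.
have lowerU c : lower u v L U c <= U c /\ (tag c != v -> lower u v L U c = U c :> nat).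
  case: lowerP => [c0 Q _ <- _ ->|_]; last by split.
  by case: eqP => [->|_]; rewrite ?eqxx ?leq_pred.
apply/refinesP=> c; rewrite inE.
have [leL eqL] := raiseL c; have [leU eqU] := lowerU c.
by split=> // cv; split; [apply: eqL|apply: eqU].
Qed.

Lemma refines_ncons (r : Constraint G) a : refines (pred1 r.1.2) (Defs.ncons R r a) a.
Proof.
case: r => [[u v] []] /=; last exact: refines_nobs.
  by apply: refines_fixA => b; apply: refines_nmono_step.
by apply: refines_fixA => b; apply: refines_nmono_step.
Qed.

Lemma refines_foldr D (R' : seq (Constraint G)) a :
  (forall r, r \in R' -> r.1.2 \in D) ->
  refines D (foldr (fun r f => Defs.ncons R r \o f) id R' a) a.
Proof.
elim: R' => [|r R' IH] nodeD; first exact: refines_refl.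
apply: refines_trans (IH _); last by move=> r' r'R; apply: nodeD; rewrite inE r'R orbT.
apply: sub_refines (refines_ncons _ _) => v; rewrite inE => /eqP->.
by apply: nodeD; rewrite mem_head.
Qed.

Lemma refines_nset D (R' : seq (Constraint G)) a :
  (forall r, r \in R' -> r.1.2 \in D) -> refines D (nset R R' a) a.
Proof. by move=> nodeD; apply: refines_fixA => b; apply: refines_foldr. Qed.

(** The iteration ends at a fixpoint of the composition. As every factor is decreasing, a value
    fixed by the composition is fixed by each factor, by antisymmetry. *)
Lemma nset_fixed (R' : seq (Constraint G)) r a : r \in R' ->
  Defs.ncons R r (nset R R' a) = nset R R' a.
Proof.
have fix_all : foldr (fun r f => Defs.ncons R r \o f) id R' (nset R R' a) = nset R R' a.
  by apply: (fixA_fixed (D := predT)) => b; apply: refines_foldr.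
move: (nset R R' a) fix_all => {}a; elim: R' => //= r' R' IH fix_all.
have fix_R' : foldr (fun r f => Defs.ncons R r \o f) id R' a = a.
  apply: (@refines_anti predT); rewrite refines_foldr // -{1}fix_all.
  by apply: sub_refines (refines_ncons _ _).
rewrite inE => /predU1P[->|]; last exact: IH.
by rewrite fix_R' in fix_all.
Qed.

(** By hypothesis the pair is the outcome of its own iteration, and such an outcome is fixed by a
    single step. *)
Lemma nmono_fixed u v pos (L U : Par G) :
  nmono u v pos (Some (L, U)) = Some (L, U) -> stepS u v pos L U = (L, U).
Proof.
move=> fixLU; have : nmono_step u v pos (Some (L, U)) = Some (L, U).
  rewrite -{1 2}fixLU; apply: (fixA_fixed (D := pred1 v)).
  exact: refines_nmono_step.
by rewrite /nmono_step /norm; case: ifP => // _ /(congr1 (odflt (L, U))).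
Qed.

Lemma nobs_fixed u v (L U : Par G) : nobs R u v (Some (L, U)) = Some (L, U) ->
  [/\ sensitive u v L U != set0, forall c, raisable u v L U != [set c]
    & forall c, lowerable u v L U != [set c]].
Proof.
rewrite nobsE /=; case: ifP => // _; case: ifP => // _ [eqL eqU]; split=> //.
  (* A singleton set would move the bound at its cell by one, so it cannot occur at a fixpoint. *)
  case: raiseP eqL => // c0 Q _ _ _ QE eqQ.
  by have := QE c0; rewrite eqQ eqxx; lia.
case: lowerP eqU => // c0 Q _ _ lt_LU QE eqQ.
by have := QE c0; rewrite eqQ eqxx; lia.
Qed.

End Refinement.

(** * Soundness: no admissible parametrisation is discarded *)

Section Soundness.
Variables (G : PRN) (R : seq (Constraint G)).
Hypothesis wfR : well_formed R.
Implicit Types (c : PIdx G) (u v : Node G) (a b : AbsD G) (P : Par G).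

Lemma gammaP P (L U : Par G) : reflect (forall c, L c <= P c <= U c)
  (P \in gamma (Some (L, U))).
Proof.
rewrite inE; apply: (iffP andP) => [[/par_leP LP /par_leP PU] c|LPU].
  by rewrite LP PU.
by split; apply/par_leP => c; have /andP[] := LPU c.
Qed.

Lemma gamma_norm a : gamma (norm a) = gamma a.
Proof.
case: a => [[L U]|] //=; case: ifP => // /negP not_LU.
apply/setP=> P; rewrite in_set0; apply/esym/(gammaP P L U) => LPU.
by apply/not_LU/par_leP => c; have /andP[] := LPU c; apply: leq_trans.
Qed.

Lemma refines_gamma D a b : refines D a b -> gamma a \subset gamma b.
Proof.
case: a b => [[L' U']|] [[L U]|] //; try by rewrite sub0set.
move=> /refinesP ref; apply/subsetP => P /gammaP LPU; apply/gammaP => c.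
have [leL leU _] := ref c; have /andP[LP PU] := LPU c.
by rewrite (leq_trans leL LP) (leq_trans PU leU).
Qed.

Lemma fixA_sound P f a : (forall b, P \in gamma b -> P \in gamma (f b)) ->
  P \in gamma a -> P \in gamma (fixA f a).
Proof. by move=> sound Pa; rewrite /fixA; elim: #|_| => //= n; apply: sound. Qed.

Lemma nmono_sound P u v (pos : bool) a :
  infl G u v ->
  (if pos then incr_in u v (fun c => P c) else decr_in u v (fun c => P c)) ->
  P \in gamma a -> P \in gamma (nmono u v pos a).
Proof.
move=> uv step_u; apply: fixA_sound => b; rewrite -(gamma_norm b).
case: (norm b) => [[L U]|] //; move/gammaP=> LPU.
rewrite [stepS _ _ _ _ _]surjective_pairing; apply/gammaP => c.
rewrite stepS_L stepS_U; case: eqP => // tc.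
have uvc : infl G u (tag c) by rewrite tc.
have [/andP[LPc PUc] le_u] := (LPU c, cget_le c u).
have down : 0 < cget c u -> if pos then P (cset c u (cget c u).-1) <= P c
    else P c <= P (cset c u (cget c u).-1).
  by move=> gt0; case: (pos) step_u => step_u; apply: step_u.
have up : cget c u < mx G u -> if pos then P c <= P (cset c u (cget c u).+1)
    else P (cset c u (cget c u).+1) <= P c.
  move=> lt_mx; have := cget_cset u lt_mx uvc; rewrite eqxx => cgetE.
  have tc' : tag (cset c u (cget c u).+1) = v by rewrite tag_cset.
  (* The constraint compares a cell with its lower neighbour, so the step up from [c] is read as the
     step down from the upper neighbour. *)
  have backE : cset (cset c u (cget c u).+1) u (cget c u) = c.
    by rewrite cset_cset // cset_cget.
  by case: (pos) step_u => /(_ _ tc'); rewrite cgetE /= backE; apply.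
have := LPU (cset c u (cget c u).-1); have := LPU (cset c u (cget c u).+1).
case: (pos) down up => down up /andP[Lu Uu] /andP[Ld Ud];
  apply/andP; split; case: ifP => // lt_u; rewrite ?geq_max ?leq_min ?LPc ?PUc /=.
- exact: leq_trans Ld (down lt_u).
- exact: leq_trans (up lt_u) Uu.
- exact: leq_trans Lu (up lt_u).
- exact: leq_trans (down lt_u) Ud.
Qed.

Lemma Pcons_obsP u v P : reflect
  (exists c (k : 'I_(mx G u).+1), [/\ tag c = v, 0 < k
     & P (cset c u k) != P (cset c u k.-1) :> nat])
  (P \in Pcons (u, v, CObs)).
Proof.
rewrite inE; apply: (iffP existsP) => [[c /andP[/eqP tc /existsP[k /andP[k_gt0 neq]]]]|].
  by exists c, k.
case=> c [k [tc k_gt0 neq]]; exists c; rewrite tc eqxx /=; apply/existsP; exists k.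
by rewrite k_gt0.
Qed.

Lemma sensitiveP u v (L U : Par G) c : reflect
  (tag c = v /\ exists2 k : 'I_(mx G u).+1, 0 < k &
     (L (cset c u k) < U (cset c u k.-1)) || (L (cset c u k.-1) < U (cset c u k)))
  (c \in sensitive u v L U).
Proof.
rewrite inE; apply: (iffP andP) => [[/eqP tc /existsP[k /andP[k_gt0 lt]]]|[tc [k gt0 lt]]].
  by split=> //; exists k.
by split; [apply/eqP|apply/existsP; exists k; rewrite gt0].
Qed.

(** Membership is a condition on the whole line in direction [u] through the cell, hence shared by
    all cells of that line. *)
Lemma sensitive_line u v (L U : Par G) c k : infl G u v -> k <= mx G u ->
  c \in sensitive u v L U -> cset c u k \in sensitive u v L U.
Proof.
move=> uv le_k /sensitiveP[tc [j j_gt0 lt_j]]; apply/sensitiveP.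
rewrite tag_cset; split=> //; exists j => //.
have le_j : j <= mx G u by rewrite -ltnS.
by rewrite !cset_cset ?tc //; lia.
Qed.

Lemma cell_le_prec v c c' : tag c = v -> tag c' = v -> cell_le R c c' = prec R v c c'.
Proof. by move=> tc tc'; rewrite /cell_le tc tc' eqxx. Qed.

(* If [P] lies above the constant [l] that [L] takes on the sensitive cells, it
   exceeds [l] at some of them, hence by monotonicity at a maximal one, and
   such a cell is raisable. *)
Lemma nobs_sound P u v a : (u, v, CObs) \in R -> satisfies R v P ->
  P \in gamma a -> P \in gamma (nobs R u v a).
Proof.
move=> uvR sat; have uv := wf_infl wfR uvR; have mP := satisfies_mono wfR sat.
rewrite nobsE -(gamma_norm a); case: (norm a) => [[L U]|] // /gammaP LPU.
have /Pcons_obsP[c [k [tc k_gt0 neq]]] := sat _ uvR erefl.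
have le_k : k <= mx G u by rewrite -ltnS.
have uvc : infl G u (tag c) by rewrite tc.
have lt_obs : (P (cset c u k) < P (cset c u k.-1)) || (P (cset c u k.-1) < P (cset c u k)).
  by rewrite -neq_ltn.
have cS : c \in sensitive u v L U.
  apply/sensitiveP; split=> //; exists k => //.
  have /andP[Lk Uk] := LPU (cset c u k); have /andP[Lk1 Uk1] := LPU (cset c u k.-1).
  by case/orP: lt_obs => lt; apply/orP; [left|right]; lia.
have ckS j : j <= mx G u -> cset c u j \in sensitive u v L U.
  by move=> le_j; apply: sensitive_line.
have le_k1 : k.-1 <= mx G u by lia.
have tS x : x \in sensitive u v L U -> tag x = v by case/sensitiveP.
have [rl lr] : cset c u k \in sensitive u v L U /\ cset c u k.-1 \in sensitive u v L U.
  by split; apply: ckS.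
case: ifP => [/eqP S0|_]; first by rewrite S0 inE in cS.
have PU x : P x <= U x by have /andP[] := LPU x.
have LP x : L x <= P x by have /andP[] := LPU x.
apply/gammaP => x; apply/andP; split.
  case: raiseP => // c0 Q B1 tc0 lt0 ->; case: eqP => // -> {x}.
  have : c0 \in raisable R u v L U by rewrite B1 set11.
  case/setIdP => c0S /andP[_ /forall_inP c0max].
  have Lconst x : x \in sensitive u v L U -> L x = L c0 :> nat.
    by move/c0max/andP=> [/eqP].
  (* [P] differs on two neighbours, both sensitive. The smaller value is at least the constant, so
     the larger one exceeds it. *)
  have [x xS lt_x] : exists2 x, x \in sensitive u v L U & L c0 < P x.
    case/orP: lt_obs => lt; [exists (cset c u k.-1)|exists (cset c u k)] => //.
      by rewrite -(Lconst _ rl); apply: leq_ltn_trans (LP _) lt.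
    by rewrite -(Lconst _ lr); apply: leq_ltn_trans (LP _) lt.
  have [y [yS xy ymax]] := finite_maximal (@cell_le_refl _ R) (@cell_le_trans _ R)
    (@cell_le_anti _ R) xS.
  have lt_y : L c0 < P y by apply: leq_trans lt_x (mP _ _ (tS _ xS) xy).
  have : y \in raisable R u v L U.
    rewrite inE yS (Lconst _ yS) (leq_trans lt_y (PU y)) /=.
    apply/forall_inP=> z zS; rewrite (Lconst _ zS) eqxx /= /incomp.
    rewrite -!(cell_le_prec (tS _ _) (tS _ _)) //.
    case yz: (cell_le R y z); last by rewrite orbN.
    by rewrite (ymax z zS yz) cell_le_refl.
  by rewrite B1 => /set1P yE; move: lt_y; rewrite yE.
case: lowerP => // c0 Q B1 tc0 lt0 ->; case: eqP => // -> {x}.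
have : c0 \in lowerable R u v L U by rewrite B1 set11.
case/setIdP => c0S /andP[_ /forall_inP c0max].
have Uconst x : x \in sensitive u v L U -> U x = U c0 :> nat.
  by move/c0max/andP=> [/eqP].
have [x xS lt_x] : exists2 x, x \in sensitive u v L U & P x < U c0.
  case/orP: lt_obs => lt; [exists (cset c u k)|exists (cset c u k.-1)] => //.
    by rewrite -(Uconst _ lr); apply: leq_trans lt (PU _).
  by rewrite -(Uconst _ rl); apply: leq_trans lt (PU _).
have [|||y [yS xy ymax]] := @finite_maximal _ (fun c c' => cell_le R c' c) _ x _ _ _ xS.
- exact: cell_le_refl.
- by move=> ? ? ? le1 le2; apply: cell_le_trans le2 le1.
- by move=> ? ? /andP[le1 le2]; apply: (@cell_le_anti _ R); apply/andP.
have lt_y : P y < U c0 by apply: leq_ltn_trans (mP _ _ (tS _ yS) xy) lt_x.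
have : y \in lowerable R u v L U.
  rewrite inE yS (Uconst _ yS) (leq_ltn_trans (LP y) lt_y) /=.
  apply/forall_inP=> z zS; rewrite (Uconst _ zS) eqxx /= /incomp.
  rewrite -!(cell_le_prec (tS _ _) (tS _ _)) //.
  case zy: (cell_le R z y); last by rewrite andbT orbN.
  by rewrite (ymax z zS zy) cell_le_refl.
by rewrite B1 => /set1P yE; rewrite yE in lt_y; rewrite -ltnS (ltn_predK lt_y).
Qed.

Lemma ncons_sound P r a : r \in R -> satisfies R r.1.2 P ->
  P \in gamma a -> P \in gamma (Defs.ncons R r a).
Proof.
case: r => [[u v] []] uvR /= sat; last exact: nobs_sound.
  apply: nmono_sound; first exact: wf_infl uvR.
  by apply/(Pcons_posP _ (wf_infl wfR uvR)); apply: sat.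
apply: nmono_sound; first exact: wf_infl uvR.
by apply/(Pcons_negP _ (wf_infl wfR uvR)); apply: sat.
Qed.

Lemma nset_sound P (R' : seq (Constraint G)) a : {subset R' <= R} ->
  (forall v, satisfies R v P) -> P \in gamma a -> P \in gamma (nset R R' a).
Proof.
move=> subR sat; apply: fixA_sound => {}a Pa.
elim: R' subR => //= r R' IH subR; apply: ncons_sound; rewrite ?subR ?mem_head //.
by apply: IH => r' r'R; apply: subR; rewrite inE r'R orbT.
Qed.

End Soundness.

(** * Completeness: the bounds of a fixpoint are attained *)

Section Completeness.
Variables (G : PRN) (R : seq (Constraint G)).
Hypothesis wfR : well_formed R.
Implicit Types (c : PIdx G) (u v : Node G) (a b : AbsD G) (P : Par G).

Definition ignores u v P := forall c k, tag c = v -> k <= mx G u ->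
  P (cset c u k) = P c :> nat.

Lemma not_obs_ignores u v P : infl G u v -> P \notin Pcons (u, v, CObs) -> ignores u v P.
Proof.
move=> uv not_obs c k tc le_k.
have uvc : infl G u (tag c) by rewrite tc.
have to0 j : j <= mx G u -> P (cset c u j) = P (cset c u 0) :> nat.
  elim: j => // j IH lt_j; rewrite -IH; last exact: ltnW.
  apply/eqP; apply: contraR not_obs => neq; apply/Pcons_obsP.
  have lt_j' : j.+1 < (mx G u).+1 by rewrite ltnS.
  by exists c, (Ordinal lt_j').
by rewrite to0 // -(to0 (cget c u)) ?cget_le // cset_cget.
Qed.

(* On a 2x2 square through [f] in directions [u] and [u'], if [W] ignores
   [u] then its variation [P] at the corner [f] cannot ignore [u']. *)
Lemma change_one_cell_obs u u' v W P f : tag f = v ->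
  infl G u v -> 0 < mx G u -> infl G u' v -> 0 < mx G u' -> ignores u v W ->
  P f != W f :> nat -> (forall c, c != f -> P c = W c :> nat) ->
  P \in Pcons (u', v, CObs).
Proof.
move=> tf uv u_gt0 u'v u'_gt0 ignW neq_f eqW; apply: contraT => /(not_obs_ignores u'v) ignP.
have uvf : infl G u (tag f) by rewrite tf.
have u'vf : infl G u' (tag f) by rewrite tf.
(* A second value for each regulator, distinct from the one in [f]; it is in range when [mx G w] is
   positive. *)
pose other w := if cget f w == 0 then 1 else 0.
have other_le w : 0 < mx G w -> other w <= mx G w by rewrite /other; case: eqP.
have otherP w : other w != cget f w by rewrite /other; case: (cget f w).
have neq_move c w : cget c w != cget f w -> c != f by apply: contraNneq => ->.
case/negP: neq_f; apply/eqP.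
have k_le := other_le u u_gt0; have j_le := other_le u' u'_gt0.
have [uu'|neq_u] := eqVneq u' u.
  rewrite uu' in ignP; rewrite -(ignP f (other u)) // eqW ?ignW //.
  by apply: (@neq_move _ u); rewrite cget_cset // eqxx otherP.
(* Go round the square from [f], first along [u'], then along [u], and back. [P] does not change
   along [u'], [W] does not change along [u], and they agree at the three other corners, which
   forces [P f = W f]. *)
rewrite -(ignP f (other u')) // eqW; last first.
  by apply: (@neq_move _ u'); rewrite cget_cset // eqxx otherP.
rewrite -(ignW _ (other u)) ?tag_cset // -eqW; last first.
  by apply: (@neq_move _ u); rewrite cget_cset ?tag_cset // eqxx otherP.
rewrite csetC // ignP ?tag_cset // eqW ?ignW //.
by apply: (@neq_move _ u); rewrite cget_cset // eqxx otherP.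
Qed.

Lemma sensitive_mx u v L U c : c \in sensitive u v L U -> 0 < mx G u.
Proof. by case/sensitiveP=> _ [k k_gt0 _]; have := ltn_ord k; lia. Qed.

(** * Bounds fixed by all the operators of a single node *)

Section Fixed.
Variables (v : Node G) (L U : Par G).
Hypothesis le_LU : Defs.leP L U.
Hypothesis fixedLU : forall r, r \in R -> r.1.2 = v ->
  Defs.ncons R r (Some (L, U)) = Some (L, U).

Lemma fixed_step u (pos : bool) c : (u, v, if pos then CPos else CNeg) \in R ->
  tag c = v -> 0 < cget c u ->
  let c' := cset c u (cget c u).-1 in
  if pos then L c' <= L c /\ U c' <= U c else L c <= L c' /\ U c <= U c'.
Proof.
move=> uvR tc c_gt0 c'.
have uv := wf_infl wfR uvR; have uvc : infl G u (tag c) by rewrite tc.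
have c_le := cget_le c u.
have tc' : tag c' = v by rewrite tag_cset.
have c'u : cget c' u = (cget c u).-1 by rewrite cget_cset ?eqxx //; lia.
have backE : cset c' u (cget c' u).+1 = c.
  by rewrite c'u prednK // cset_cset ?cset_cget //; lia.
have c'_lt : cget c' u < mx G u by rewrite c'u; lia.
have fixS : stepS u v pos L U = (L, U).
  by apply: nmono_fixed; have := fixedLU uvR erefl; case: (pos).
have eqL x : L x = (stepS u v pos L U).1 x :> nat by rewrite fixS.
have eqU x : U x = (stepS u v pos L U).2 x :> nat by rewrite fixS.
(* The fixpoint equation for [L] is needed at the larger end of the edge in the order on cells, the
   one for [U] at the smaller end. *)
have := eqL c; have := eqL c'; have := eqU c; have := eqU c'.
rewrite !stepS_L !stepS_U (introT eqP tc) (introT eqP tc') c_gt0 c'_lt backE -/c'.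
by case: (pos) => [-> _ _ ->|_ -> -> _]; rewrite geq_minr leq_maxr.
Qed.

Lemma fixed_mono : mono_at R v (fun c => L c) /\ mono_at R v (fun c => U c).
Proof.
by split; apply: steps_mono_at => // u uv c tc c_gt0;
  [have := @fixed_step u true|have := @fixed_step u false|
   have := @fixed_step u true|have := @fixed_step u false];
  move=> /(_ c uv tc c_gt0)[].
Qed.

Lemma fixed_sensitive u : (u, v, CObs) \in R -> sensitive u v L U != set0.
Proof. by move=> uvR; have [] := nobs_fixed (fixedLU uvR erefl). Qed.

Lemma obs_mx_gt0 u : (u, v, CObs) \in R -> 0 < mx G u.
Proof. by move/fixed_sensitive => /set0Pn[c /sensitive_mx]. Qed.

Lemma mono_satisfies P : mono_at R v (fun c => P c) ->
  (forall u, (u, v, CObs) \in R -> P \in Pcons (u, v, CObs)) -> satisfies R v P.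
Proof.
move=> mP obsP [[u w] s] uvR wv; have {}wv : w = v := wv; rewrite wv in uvR *.
have [sE|s_sign] := eqVneq s CObs; last exact (mono_Pcons wfR mP uvR s_sign).
by rewrite sE in uvR *; apply: obsP.
Qed.

Lemma all_obs_or P : (forall u, (u, v, CObs) \in R -> P \in Pcons (u, v, CObs)) \/
  exists2 u, (u, v, CObs) \in R & ignores u v P.
Proof.
have [/forallP obsP|/forallPn[u]] := boolP
  [forall u : Node G, ((u, v, CObs) \in R) ==> (P \in Pcons (u, v, CObs))].
  by left=> u uvR; apply: (implyP (obsP u)).
rewrite negb_imply => /andP[uvR not_obs]; right; exists u => //.
exact: not_obs_ignores (wf_infl wfR uvR) not_obs.
Qed.

Lemma ignores_pred u W c (k : 'I_(mx G u).+1) : ignores u v W -> tag c = v ->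
  W (cset c u k) = W c :> nat /\ W (cset c u k.-1) = W c :> nat.
Proof.
move=> ignW tc; have le_k : k <= mx G u by rewrite -ltnS.
by rewrite !ignW //; apply: leq_trans (leq_pred _) le_k.
Qed.

(** One of the bounds is constant along [u], so the gap [L c < U c] persists when that bound is read
    at a neighbour of [c]. *)
Lemma free_sensitive u W c : (u, v, CObs) \in R -> W = L \/ W = U -> ignores u v W ->
  tag c = v -> L c < U c -> c \in sensitive u v L U.
Proof.
move=> uvR WLU ignW tc free_c; apply/sensitiveP; split=> //.
have u_gt0 := obs_mx_gt0 uvR.
have uvc : infl G u (tag c) by rewrite tc (wf_infl wfR uvR).
have c_le := cget_le c u.
(* The neighbour is the one above if [c] has component 0 at [u], and the one below otherwise. *)
have [c0|c_gt0] := posnP (cget c u).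
  have lt1 : 1 < (mx G u).+1 by [].
  exists (Ordinal lt1) => //=.
  have c_eq : cset c u 0 = c by rewrite -c0 cset_cget.
  have [W1 _] := ignores_pred (Ordinal lt1) ignW tc.
  rewrite c_eq /=; case: WLU W1 => -> /= W1; rewrite W1 free_c ?orbT //.
have lt_c : cget c u < (mx G u).+1 by [].
exists (Ordinal lt_c) => //=; rewrite cset_cget //.
have [_ W1] := ignores_pred (Ordinal lt_c) ignW tc.
by case: WLU W1 => -> /= W1; rewrite W1 free_c ?orbT.
Qed.

Lemma sensitive_free u W c : W = L \/ W = U -> ignores u v W ->
  c \in sensitive u v L U ->
  exists d, [/\ tag d = v, L d < U d & W d = W c :> nat].
Proof.
move=> WLU ignW /sensitiveP[tc [k k_gt0]].
have [Wk Wk1] := ignores_pred k ignW tc.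
have tk j : tag (cset c u j) = v by rewrite tag_cset.
case: WLU Wk Wk1 => -> Wk Wk1 /orP[lt|lt].
- by exists (cset c u k.-1); split=> //; rewrite Wk1 -Wk.
- by exists (cset c u k); split=> //; rewrite Wk -Wk1.
- by exists (cset c u k); split=> //; rewrite Wk -Wk1.
by exists (cset c u k.-1); split=> //; rewrite Wk1 -Wk.
Qed.

Lemma sensitive_tag u c : c \in sensitive u v L U -> tag c = v.
Proof. by case/sensitiveP. Qed.

(** Brings the set to the shape expected by [free_level_max]; [lowerableE] does so for the reversed
    order and complemented values. *)
Lemma raisableE u : raisable R u v L U =
  [set c in sensitive u v L U | (L c < U c) && [forall c' in sensitive u v L U,
     ((L c : nat) == L c') && (cell_le R c' c || ~~ cell_le R c c')]].
Proof.
apply/setP=> c; rewrite [LHS]in_set [RHS]in_set; case cS: (c \in sensitive _ _ _ _) => //=.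
congr (_ && _); apply: eq_forallb_in => c' c'S; congr (_ && _).
by rewrite /incomp !(@cell_le_prec _ _ v) ?(@sensitive_tag u) //; case: prec; rewrite ?andbT.
Qed.

Lemma lowerableE u : lowerable R u v L U =
  [set c in sensitive u v L U | (mx G v - U c < mx G v - L c) &&
     [forall c' in sensitive u v L U, (mx G v - U c == mx G v - U c') &&
       (cell_le R c c' || ~~ cell_le R c' c)]].
Proof.
apply/setP=> c; rewrite [LHS]in_set [RHS]in_set; case cS: (c \in sensitive _ _ _ _) => //=.
have leU d : d \in sensitive u v L U -> U d <= mx G v.
  by move/sensitive_tag => <-; apply: Par_le.
congr (_ && _); first by rewrite ltn_sub2lE ?leU.
apply: eq_forallb_in => c' c'S; congr (_ && _).
  by rewrite eqn_sub2lE ?leU.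
rewrite /incomp !(@cell_le_prec _ _ v) ?(@sensitive_tag u) //.
by case: (prec R v c c'); rewrite ?andbT.
Qed.

(** With [o = None] this only asks for some parametrisation between the bounds; that case yields
    nonemptiness of the hull. *)
Definition extended (W : Par G) (o : option (PIdx G)) := exists P,
  [/\ forall c, L c <= P c <= U c, satisfies R v P
    & forall c, o = Some c -> P c = W c :> nat].

Lemma change_satisfies u W P f : (u, v, CObs) \in R -> ignores u v W -> tag f = v ->
  P f != W f :> nat -> (forall c, c != f -> P c = W c :> nat) ->
  mono_at R v (fun c => P c) -> satisfies R v P.
Proof.
move=> uvR ignW tf neq_f eqW mP; apply: mono_satisfies => // u' u'vR.
apply: (change_one_cell_obs tf) ignW neq_f eqW;
  do ?[exact: wf_infl u'vR|exact: wf_infl uvR|exact: obs_mx_gt0].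
Qed.

Lemma lower_attained o : extended L o.
Proof.
have LU c : L c <= U c by move/par_leP: le_LU.
have [mL mU] := fixed_mono.
have [obsL|[u uvR ignL]] := all_obs_or L.
  by exists L; split=> // [c|]; [rewrite leqnn LU|apply: mono_satisfies].
have [S_n0 not_raisable _] := nobs_fixed (fixedLU uvR erefl).
(* The cell [o], where [L] has to be attained, is the one that must not be raised. *)
have [f [/eqP tf free_f of_neq fmax]] : exists f, [/\ tag f == v, L f < U f, o != Some f
    & forall g, cell_le R f g -> g != f -> L f < L g].
  apply: (@free_level_max _ _ (fun c => tag c == v) _ (fun c => L c) (fun c => U c) o
    (@cell_le_refl _ R) (@cell_le_trans _ R) (@cell_le_anti _ R) _ _ _ _ S_n0) => [c c'|c|c|c|c].
  - move=> /eqP tc le_c; split; [|exact: mL|exact: mU].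
    by rewrite -(eqP (andP le_c).1) tc.
  - by move/sensitive_tag/eqP.
  - by move/eqP; apply: free_sensitive uvR (or_introl erefl) ignL.
  - move/(sensitive_free (or_introl erefl) ignL) => [d [/eqP td free_d eq_d]].
    by exists d.
  by rewrite -raisableE.
have f_mx : (L f).+1 <= mx G (tag f) by apply: leq_trans free_f (Par_le _ _).
have PE c : upd L f (L f).+1 c = (if c == f then (L f).+1 else L c) :> nat by rewrite updE.
exists (upd L f (L f).+1); split=> [c||c oc].
- by rewrite PE; case: eqP => [->|_]; rewrite ?leqnSn ?leqnn ?LU.
- apply: (change_satisfies uvR ignL tf) => [|c /negbTE cf|c c' tc le_c].
  + by rewrite PE eqxx; lia.
  + by rewrite PE cf.
  (* Only pairs with lower end [f] are at risk, and there maximality in the level set leaves room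
     for the extra unit. *)
  rewrite !PE; case: (eqVneq c f) le_c => [-> le_c|cf le_c]; last first.
    have := mL c c' tc le_c; case: eqP => [->|_] //; exact: leqW.
  by case: eqP => // /eqP c'f; apply: fmax.
by rewrite PE; case: eqP => // cf; rewrite oc cf eqxx in of_neq.
Qed.

(* The previous argument for the reverse order, with [m_v - U] and [m_v - L]
   in the roles of [L] and [U]. *)
Lemma upper_attained o : extended U o.
Proof.
have LU c : L c <= U c by move/par_leP: le_LU.
have [mL mU] := fixed_mono.
have [obsU|[u uvR ignU]] := all_obs_or U.
  by exists U; split=> // [c|]; [rewrite leqnn LU|apply: mono_satisfies].
have [S_n0 _ not_lowerable] := nobs_fixed (fixedLU uvR erefl).
have U_mx c : tag c = v -> U c <= mx G v by move=> <-; apply: Par_le.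
have [f [/eqP tf free_f of_neq fmax]] : exists f, [/\ tag f == v,
    mx G v - U f < mx G v - L f, o != Some f
    & forall g, cell_le R g f -> g != f -> mx G v - U f < mx G v - U g].
  apply: (@free_level_max _ (fun c c' => cell_le R c' c) (fun c => tag c == v) _
    (fun c => mx G v - U c) (fun c => mx G v - L c) o _ _ _ _ _ _ _ S_n0)
    => [|c2 c1 c3|c c'|c c'|c|c|c|c].
  - exact: cell_le_refl.
  - by move=> le1 le2; apply: cell_le_trans le2 le1.
  - by move=> /andP[le1 le2]; apply: (@cell_le_anti _ R); rewrite le1 le2.
  - move=> /eqP tc le_c; have tc' : tag c' = v by rewrite (eqP (andP le_c).1).
    by split; [apply/eqP|apply: leq_sub2l; apply: mU|apply: leq_sub2l; apply: mL].
  - by move/sensitive_tag/eqP.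
  - move/eqP=> tc; have := U_mx c tc; have := LU c => LUc Uc lt_c.
    by apply: (free_sensitive uvR (or_intror erefl) ignU tc); lia.
  - move/(sensitive_free (or_intror erefl) ignU) => [d [td free_d eq_d]].
    exists d; rewrite eq_d; split; rewrite // ?td // -eq_d.
    by rewrite ltn_sub2lE ?U_mx.
  by rewrite -lowerableE.
have lt_LU : L f < U f by lia.
have PE c : upd U f (U f).-1 c = (if c == f then (U f).-1 else U c) :> nat.
  by rewrite updE //; apply: leq_trans (leq_pred _) (Par_le _ _).
exists (upd U f (U f).-1); split=> [c||c oc].
- rewrite PE; case: eqP => [->|_]; last by rewrite LU leqnn.
  by rewrite leq_pred andbT -ltnS (ltn_predK lt_LU).
- apply: (change_satisfies uvR ignU tf) => [|c /negbTE cf|c c' tc le_c].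
  + by rewrite PE eqxx neq_ltn ltn_predL (leq_ltn_trans _ lt_LU).
  + by rewrite PE cf.
  have := mU c c' tc le_c.
  rewrite !PE; case: (eqVneq c' f) le_c => [-> le_c|cf le_c] leU; last first.
    by case: eqP leU => [->|_] //; apply: leq_trans (leq_pred _).
  case: eqP => // /eqP cf; have := fmax c le_c cf; have := U_mx c tc.
  by move: lt_LU; lia.
by rewrite PE; case: eqP => // cf; rewrite oc cf eqxx in of_neq.
Qed.

End Fixed.
End Completeness.

Lemma mem_bigcap_seq (I : Type) (T : finType) (F : I -> {set T}) (s : seq I) x :
  (x \in \bigcap_(i <- s) F i) = all (fun i => x \in F i) s.
Proof. by elim: s => [|i s IH]; rewrite ?big_nil ?big_cons inE ?IH. Qed.

(** * Induction on the transitions, gluing of nodes, and the hull *)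

Section Main.
Variables (G : PRN) (R : seq (Constraint G)).
Hypothesis wfR : well_formed R.
Implicit Types (c : PIdx G) (u v : Node G) (a b : AbsD G) (P : Par G).

Lemma pRP s P : reflect
  ((forall t, t \in s -> P \in Ptrans t) /\ forall v, satisfies R v P) (P \in pR R s).
Proof.
rewrite inE !mem_bigcap_seq.
apply: (iffP andP) => [[/allP in_s /allP in_R]|[in_s sat]]; split=> //.
- by move=> v r rR _; apply: in_R.
- exact/allP.
by apply/allP=> r rR; apply: (sat r.1.2).
Qed.

(** For an increasing transition, validity keeps the new bound $x_v+1$ within range, so [mkPar] does
    not clamp it. *)
Lemma ntransE (t : Trans G) a : valid_trans t ->
  match norm a with
  | None => ntrans t a = None
  | Some (L, U) => exists L' U', [/\ ntrans t a = Some (L', U'),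
      forall c, L' c = (if t.2 && (c == existT (@Omega G) (tnode t) (proj t.1.1 (tnode t)))
                        then maxn (L c) (t.1.1 (tnode t) + 1) else L c) :> nat
    & forall c, U' c = (if ~~ t.2 && (c == existT (@Omega G) (tnode t) (proj t.1.1 (tnode t)))
                        then minn (U c) (t.1.1 (tnode t) - 1) else U c) :> nat]
  end.
Proof.
case: t => [[x v] pos] /= valid_t; rewrite /ntrans.
case: (norm a) => [[L U]|] //; set c0 := existT _ _ _.
case: pos valid_t => valid_t /=.
  exists (pmax L (upd (bot G) c0 (x v + 1))), U; split=> // c.
  have x_le : x v + 1 <= mx G (tag c0) by rewrite addn1.
  rewrite mkParE ?geq_max ?Par_le // updE //; case: eqP => [->|_] //.
  by rewrite mkParE // maxn0.
exists L, (pmin U (upd (top G) c0 (x v - 1))); split=> // c.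
have x_le : x v - 1 <= mx G (tag c0) by rewrite leq_subLR leqW // -ltnS ltn_ord.
rewrite mkParE ?geq_min ?Par_le // updE //; case: eqP => [->|_] //.
by rewrite mkParE //; apply/minn_idPl/Par_le.
Qed.

Lemma refines_ntrans (t : Trans G) a : valid_trans t ->
  refines (pred1 (tnode t)) (ntrans t a) a.
Proof.
move=> valid_t; apply: refines_trans (refines_norm _ a).
have := ntransE a valid_t; case: (norm a) => [[L U]|-> //].
move=> [L' [U' [-> L'E U'E]]]; apply/refinesP => c; rewrite L'E U'E.
split; try by case: ifP; rewrite ?leq_maxl ?geq_minl.
by case: eqP => [->|]; rewrite ?inE ?eqxx ?andbF.
Qed.

(** Narrowing by a transition is exact, because its condition is itself a bound on one
    coordinate. *)
Lemma gamma_ntrans (t : Trans G) a : valid_trans t ->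
  gamma (ntrans t a) = gamma a :&: Ptrans t.
Proof.
move=> valid_t; have /subsetP sub_a := refines_gamma (refines_ntrans a valid_t).
apply/setP=> P; rewrite in_setI; apply/idP/andP => [Pt|[]].
  split; first exact: sub_a.
  move: Pt; have := ntransE a valid_t; case: (norm a) => [[L U]|->]; last by rewrite inE.
  case: t {valid_t sub_a} => [[x v] pos] /= [L' [U' [-> L'E U'E]]].
  move/gammaP/(_ (existT _ v (proj x v))); rewrite L'E U'E eqxx !andbT.
  case: (pos) => /=; rewrite inE; first by rewrite geq_max => /andP[/andP[]].
  by rewrite leq_min => /and3P[].
rewrite -(gamma_norm a); have := ntransE a valid_t.
case: (norm a) => [[L U]|_]; last by rewrite inE.
case: t {valid_t sub_a} => [[x v] pos] /= [L' [U' [-> L'E U'E]]] /gammaP LPU Pt.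
apply/gammaP=> c; rewrite L'E U'E; have /andP[] := LPU c.
by case: (pos) Pt => /=; rewrite inE => Pt; case: eqP => [->|_] Lc Uc;
  rewrite ?geq_max ?leq_min Lc Uc ?Pt.
Qed.

(** Unlike [extended], this constrains only the cells of [v], so it survives any change of the
    bounds at other nodes. *)
Definition attains v (L U W : Par G) (o : option (PIdx G)) := exists P,
  [/\ forall c, tag c = v -> L c <= P c <= U c, satisfies R v P
    & forall c, tag c = v -> o = Some c -> P c = W c :> nat].

Definition complete a := forall L U, norm a = Some (L, U) ->
  forall v o, attains v L U L o /\ attains v L U U o.

Lemma fixed_attains v a L U : norm a = Some (L, U) ->
  (forall r, r \in R -> r.1.2 = v -> Defs.ncons R r a = a) ->
  forall o, attains v L U L o /\ attains v L U U o.
Proof.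
case: a => [[L0 U0]|] //=; case: ifP => // leLU [eqL eqU].
rewrite eqL eqU in leLU * => fixed o.
have [P [LPU satP PL]] := lower_attained wfR leLU fixed o.
have [Q [LQU satQ QU]] := upper_attained wfR leLU fixed o.
by split; [exists P|exists Q]; split=> // c _; auto.
Qed.

Lemma norm_Some a L U : norm a = Some (L, U) -> a = Some (L, U).
Proof. by case: a => [[L0 U0]|] //=; case: ifP. Qed.

(** At the node of the last transition, the result is fixed by every constraint on that node. At any
    other node the bounds are those of the previous step, and the induction hypothesis carries
    over. *)
Lemma psharp_complete s : all (@valid_trans G) s -> complete (psharp R s).
Proof.
elim: s => [|t s IH] /=.
  move=> _ L U normE v o; apply: fixed_attains normE _ _ => r rR _.
  exact: nset_fixed.
move=> /andP[valid_t valid_s] L U normE v o.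
have [tv|vt] := eqVneq (tnode t) v.
  apply: fixed_attains normE _ _ => r rR rv; apply: nset_fixed.
  by rewrite mem_filter rR rv tv eqxx.
set R' := [seq r <- R | _] in normE; set b := ntrans t _ in normE.
have ref_b : refines (pred1 (tnode t)) (nset R R' b) b.
  by apply: refines_nset => r; rewrite mem_filter => /andP[].
have ref_a : refines (pred1 (tnode t)) b (norm (psharp R s)).
  rewrite /b; have := refines_ntrans (norm (psharp R s)) valid_t.
  by rewrite /ntrans; case: (psharp R s) => [[L0 U0]|] //=; case: ifP => //= ->.
have := refines_trans ref_b ref_a; rewrite (norm_Some normE).
case a_norm: (norm (psharp R s)) => [[La Ua]|] // /refinesP ref.
have eqLU c : tag c = v -> L c = La c :> nat /\ U c = Ua c :> nat.
  by move=> tc; have [_ _] := ref c; apply; rewrite inE tc eq_sym.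
have [[P [LPU satP PL]] [Q [LQU satQ QU]]] := IH valid_s _ _ a_norm v o.
split; [exists P|exists Q]; split=> // c tc.
- by have [-> ->] := eqLU c tc; apply: LPU.
- by have [-> _] := eqLU c tc; apply: PL.
- by have [-> ->] := eqLU c tc; apply: LQU.
by have [_ ->] := eqLU c tc; apply: QU.
Qed.

Lemma Pcons_local v P (Q : Par G) (r : Constraint G) : r.1.2 = v ->
  (forall c, tag c = v -> P c = Q c :> nat) -> Q \in Pcons r -> P \in Pcons r.
Proof.
case: r => [[u w] s] wv; have {}wv : w = v := wv; subst w => eqPQ.
have eqk c k : tag c = v -> P (cset c u k) = Q (cset c u k) :> nat.
  by move=> tc; apply: eqPQ; rewrite tag_cset.
case: s; rewrite !inE.
- move/forallP=> inQ; apply/forallP=> c; have := inQ c; case: eqP => //= tc /forallP inQc.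
  by apply/forallP=> k; rewrite !eqk.
- move/forallP=> inQ; apply/forallP=> c; have := inQ c; case: eqP => //= tc /forallP inQc.
  by apply/forallP=> k; rewrite !eqk.
move=> /existsP[c /andP[/eqP tc /existsP[k inQ]]]; apply/existsP; exists c.
by rewrite (introT eqP tc) /=; apply/existsP; exists k; rewrite !eqk.
Qed.

Lemma glue_attains (L U W : Par G) o : (forall v, attains v L U W o) ->
  exists P, [/\ P \in gamma (Some (L, U)), forall v, satisfies R v P
              & forall c, o = Some c -> P c = W c :> nat].
Proof.
move=> /fin_all_exists[Q QP].
(* Each cell takes its value from the witness chosen for its own node; this suffices since a
   constraint only reads the cells of its target. *)
pose P := mkPar (fun c => Q (tag c) c).
have PE c v : tag c = v -> P c = Q v c :> nat by move<-; rewrite mkParE ?Par_le.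
exists P; split=> [|v r rR rv|c oc].
- by apply/gammaP => c; rewrite (PE c _ erefl); have [LQU _ _] := QP (tag c); apply: LQU.
- by have [_ satQ _] := QP v; apply: (Pcons_local rv) (satQ r rR rv) => c /PE.
by rewrite (PE c _ erefl); have [_ _ QW] := QP (tag c); apply: QW.
Qed.

Lemma hullE (X : {set Par G}) (L U : Par G) : X \subset gamma (Some (L, U)) ->
  (forall o, exists2 P, P \in X & forall c, o = Some c -> P c = L c :> nat) ->
  (forall o, exists2 P, P \in X & forall c, o = Some c -> P c = U c :> nat) ->
  hull X = Some (L, U).
Proof.
move=> /subsetP subX attL attU; rewrite /hull.
have [P0 P0X _] := attL None.
case: eqP => [X0|_]; first by rewrite X0 inE in P0X.
have X_LU P c : P \in X -> L c <= P c <= U c by move/subX/gammaP.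
congr (Some (_, _)); apply: Par_ext => c.
  have [P PX PL] := attL (Some c).
  have minE : \big[minn/mx G (tag c)]_(P in X) (P c : nat) = L c.
    apply/eqP; rewrite eqn_leq; apply/andP; split.
      by rewrite -PL //; apply: (@Order.TotalTheory.bigmin_le_cond _ nat).
    (* The default value of the minimum, [mx G (tag c)], is also at least [L c]. *)
    elim/big_ind: _ => [|x y Lx Ly|Q QX]; first exact: Par_le.
      by rewrite leq_min Lx.
    by have /andP[] := X_LU Q c QX.
  by rewrite mkParE minE ?Par_le.
have [P PX PU] := attU (Some c).
have maxE : \max_(P in X) (P c : nat) = U c.
  apply/eqP; rewrite eqn_leq; apply/andP; split.
    by apply/bigmax_leqP=> Q QX; have /andP[] := X_LU Q c QX.
  by rewrite -PU //; apply: (bigmax_sup P).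
by rewrite mkParE maxE ?Par_le.
Qed.

Lemma psharp_sound s : all (@valid_trans G) s -> pR R s \subset gamma (psharp R s).
Proof.
move=> valid_s; apply/subsetP => P /pRP[in_s sat].
elim: s valid_s in_s => [|t s IH] /=.
  move=> _ _; apply: nset_sound => //; apply/gammaP => c.
  by rewrite !mkParE // Par_le.
move=> /andP[valid_t valid_s] in_s; apply: nset_sound => //.
  by move=> r; rewrite mem_filter => /andP[].
rewrite gamma_ntrans // inE in_s ?mem_head // andbT.
by apply: IH => // t' t's; apply: in_s; rewrite inE t's orbT.
Qed.

(** Once imposed, the bound of a transition is never lost, since later operators only shrink the
    interval. *)
Lemma psharp_ptr s P : all (@valid_trans G) s -> P \in gamma (psharp R s) ->
  forall t, t \in s -> P \in Ptrans t.
Proof.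
elim: s => //= t s IH /andP[valid_t valid_s] Pa t'.
have : P \in gamma (ntrans t (psharp R s)).
  move: Pa; apply/subsetP/(@refines_gamma _ predT).
  exact: refines_nset.
rewrite gamma_ntrans // => /setIP[Ps Pt]; rewrite inE => /predU1P[-> //|].
exact: IH.
Qed.

End Main.

Theorem theorem2 (G : PRN) (R : seq (Constraint G)) (s : seq (Trans G)) :
  well_formed R -> uniq R ->
  all (@valid_trans G) s -> uniq s ->
  gamma (psharp R s) = gamma (hull (pR R s)).
Proof.
move=> wfR _ valid_s _; rewrite -gamma_norm.
have := psharp_sound wfR valid_s; rewrite -gamma_norm.
case a_norm: (norm (psharp R s)) => [[L U]|] sound; last first.
  (* If the abstract value is empty, soundness makes [pR R s] empty as well. *)
  by move: sound; rewrite subset0 => /eqP->; rewrite /hull eqxx.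
have compl := psharp_complete wfR valid_s a_norm.
(* The witnesses, known to lie in the interval and to satisfy [R], also respect the transitions, so
   they belong to [pR R s]. *)
have inX P : P \in gamma (Some (L, U)) -> (forall v, satisfies R v P) -> P \in pR R s.
  move=> PLU sat; apply/pRP; split=> //; apply: (psharp_ptr (R := R) valid_s).
  by rewrite -gamma_norm a_norm.
congr gamma; apply/esym/hullE => // o.
  have [|P [PLU sat PL]] := @glue_attains _ R L U L o; first by move=> v; apply: (compl v o).1.
  by exists P => //; apply: inX.
have [|P [PLU sat PU]] := @glue_attains _ R L U U o; first by move=> v; apply: (compl v o).2.
by exists P => //; apply: inX.
Qed.
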